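(* Let $n,k,l$ be positive integers, $A\in\mathbb{Z}^{k\times l}$, $b\in\mathbb{Z}^k$. There exist unimodular matrices $P\in\mathbb{Z}^{k\times k}$, $Q\in\mathbb{Z}^{(k+l)\times(k+l)}$ such that $P[A,-nI]Q=[S,0]$, where $S=\mathrm{diag}(f_1,\dots,f_k)$ is the $k\times k$ nonsingular diagonal matrix of invariant factors of $[A,-nI]$ and $[S,0]$ is $k\times(k+l)$ with $l$ zero columns added. For such $P,Q$, let $\tilde b=Pb=[\beta_1,\dots,\beta_k]^T$. The integral system $$[A,\,-nI]\begin{bmatrix} x \\ y \end{bmatrix}=b,\qquad x\in\mathbb{Z}^l,\ y\in\mathbb{Z}^k,$$ has a solution if and only if $x_0=S^{-1}Pb$ is integral, equivalently $f_i\mid\beta_i$ for all $i=1,\dots,k$. In that case, all solutions are $$\begin{bmatrix} x \\ y \end{bmatrix}=Q\begin{bmatrix} x_0 \\ x_1 \end{bmatrix},$$ where $x_1\in\mathbb{Z}^l$ is arbitrary.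
   Context: $I$ is the $k\times k$ identity. An integer square matrix is unimodular if its determinant is $\pm1$. The invariant factors are the positive integers $f_1\mid f_2\mid\dots\mid f_k$ on the diagonal of the Smith canonical form. *)

(* Defs.v *)
From HB Require Import structures.
From mathcomp Require Import all_boot all_order all_algebra.

Set Implicit Arguments.
Unset Strict Implicit.
Unset Printing Implicit Defensive.

Import Order.TTheory GRing.Theory Num.Theory.
Local Open Scope ring_scope.

Definition unimodular (m : nat) (U : 'M[int]_m) : Prop :=
  \det U = 1 \/ \det U = -1.

(* The diagonal is f, padded with zeros. The bound on [size f] is needed
   because entries of f past the last row or column would be dropped. *)
Definition smith_mx (m p : nat) (f : seq int) : 'M[int]_(m, p) :=
  \matrix_(i < m, j < p) (f`_i *+ (i == j :> nat)).

Definition invariant_factors (m p : nat) (M : 'M[int]_(m, p)) (f : seq int)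
    : Prop :=
  [/\ (size f <= minn m p)%N,
      all (fun d : int => 0 < d) f,
      sorted dvdz f
    & exists (U : 'M[int]_m) (V : 'M[int]_p),
        [/\ unimodular U, unimodular V & U *m M *m V = smith_mx m p f]].

Definition diag_of_tuple (k : nat) (f : k.-tuple int) : 'M[int]_k :=
  diag_mx (\row_(i < k) tnth f i).

Definition mxQ (m p : nat) (M : 'M[int]_(m, p)) : 'M[rat]_(m, p) :=
  map_mx (intr : int -> rat) M.

(* [A, B] has l + k columns while [S, 0] has k + l; these two casts identify
   the index types 'I_(k + l) and 'I_(l + k) by the value of the index, so they
   leave all entries in place. *)
Definition cast_cols (R : Type) (m k l : nat) (M : 'M[R]_(m, k + l))
    : 'M[R]_(m, l + k) := castmx (erefl m, addnC k l) M.

Definition cast_rows (R : Type) (m k l : nat) (M : 'M[R]_(k + l, m))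
    : 'M[R]_(l + k, m) := castmx (addnC k l, erefl m) M.

(* Main.v *)
(** Both [M z = b] and [(P M Q) (Q^-1 z) = P b] describe the same integral
    solutions, and the latter reads [S w0 = P b], with [w1] free, where
    [Q^-1 z = (w0, w1)].  That the diagonal of [S] has no zeros comes from
    [M] having the right quasi-inverse [(0, -I)]: [M (0, -I)^T = n I]. *)
Require Import Defs.
From HB Require Import structures.
From mathcomp Require Import all_boot all_order all_algebra.

Import Order.TTheory GRing.Theory Num.Theory.
Local Open Scope ring_scope.

(** The units of the integers are [1] and [-1], so unimodular matrices are those with an integral
    inverse [invmx]. *)
Lemma unimodularP (m : nat) (U : 'M[int]_m) :
  reflect (unimodular U) (U \in unitmx).
Proof.
rewrite unitmxE unfold_in /= /intUnitRing.unitz.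
by apply: (iffP orP) => -[/eqP|/eqP]; rewrite /unimodular; auto.
Qed.

Lemma castmx_mul_inner (R : pzRingType) (m p q r : nat) (e : p = q)
    (X : 'M[R]_(m, p)) (Y : 'M[R]_(p, r)) :
  castmx (erefl m, e) X *m castmx (e, erefl r) Y = X *m Y.
Proof. by case: q / e; rewrite !castmx_id. Qed.

Lemma cast_rowsK (R : Type) (m k l : nat) (N : 'M[R]_(l + k, m)) :
  cast_rows (castmx (addnC l k, erefl m) N) = N.
Proof. by rewrite /cast_rows castmx_comp castmx_id. Qed.

Lemma smith_mxE (k l : nat) (f : k.-tuple int) :
  smith_mx k (l + k) f = cast_cols (row_mx (diag_of_tuple f) (0 : 'M_(k, l))).
Proof.
apply/matrixP=> i j; rewrite castmxE !mxE /= cast_ord_id.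
case: splitP => j' /= ej; rewrite !mxE ej.
  by rewrite (tnth_nth 0).
(* A column of the zero block has index at least [k], hence never meets the diagonal. *)
by rewrite ltn_eqF ?mulr0n // (leq_trans (ltn_ord i)) ?leq_addr.
Qed.

Lemma mxQ_mul (m p q : nat) (X : 'M[int]_(m, p)) (Y : 'M[int]_(p, q)) :
  mxQ (X *m Y) = mxQ X *m mxQ Y.
Proof. exact: map_mxM. Qed.

Lemma mxQ_inj (m p : nat) : injective (@mxQ m p).
Proof.
move=> X Y /matrixP eXY; apply/matrixP=> i j.
by have := eXY i j; rewrite !mxE => /intr_inj.
Qed.

Lemma mxOver_intP (m p : nat) (X : 'M[rat]_(m, p)) :
  reflect (exists Y, X = mxQ Y) (X \is a mxOver Num.int).
Proof.
apply: (iffP mxOverP) => [XZ | [Y -> i j]]; last by rewrite mxE intr_int.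
exists (\matrix_(i, j) Num.floor (X i j)).
by apply/matrixP=> i j; rewrite !mxE floorK.
Qed.

(** A zero at position [i] kills row [i] of [invmx L *m M], hence that of [invmx L *m M *m X], which
    is [c] times [invmx L]; an invertible matrix has no zero row. *)
Lemma smith_diag_neq0 (k p : nat) (M : 'M[int]_(k, p)) (X : 'M[int]_(p, k))
    (c : int) (L : 'M[int]_k) (R : 'M[int]_p) (d : seq int) (i : 'I_k) :
  c != 0 -> M *m X = c%:M -> L \in unitmx ->
  M = L *m smith_mx k p d *m R -> d`_i != 0.
Proof.
move=> c0 MX uL eM; apply/eqP=> di0.
have row0 : row i (invmx L *m M) = 0.
  rewrite eM -mulmxA mulKmx // row_mul; apply/rowP=> j.
  by rewrite !mxE big1 // => s _; rewrite !mxE di0 mul0rn mul0r.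
have : row i (invmx L *m M *m X) = 0 by rewrite row_mul row0 mul0mx.
rewrite -mulmxA MX mul_mx_scalar => rowL0.
have {}rowL0 : row i (invmx L) = 0.
  apply/rowP=> j; have /rowP/(_ j)/eqP := rowL0.
  by rewrite !mxE mulf_eq0 (negPf c0) => /eqP.
have /rowP/(_ i)/eqP : row i (invmx L *m L) = 0.
  by rewrite row_mul rowL0 mul0mx.
by rewrite mulVmx // !mxE eqxx.
Qed.

(** The Smith form of the library leaves the length and the signs of [d] open: [d] is cut to its
    first [k] entries and replaced by absolute values. *)
Lemma invariant_factors_exist (k p : nat) (M : 'M[int]_(k, p))
    (X : 'M[int]_(p, k)) (c : int) :
  (k <= p)%N -> c != 0 -> M *m X = c%:M ->
  exists f : k.-tuple int, invariant_factors M f.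
Proof.
move=> kp c0 MX; have [L uL [R uR [d dvd_d eM]]] := int_Smith_normal_form M.
have nz (i : 'I_k) : d`_i != 0 by exact: smith_diag_neq0 c0 MX uL eM.
have kd : (k <= size d)%N.
  rewrite leqNgt; apply/negP=> dk.
  (* At index [size d], [nth] returns its default [0], against [nz]. *)
  by have := nz (Ordinal dk); rewrite nth_default ?eqxx.
have sz : size [seq (`|x|%N : int) | x <- take k d] == k.
  by rewrite size_map size_takel.
exists (Tuple sz); split=> /=.
- by rewrite (eqP sz) leq_min leqnn.
- apply/(all_nthP 0) => i; rewrite (eqP sz) => ik.
  rewrite (nth_map 0) ?size_takel // nth_take //.
  by rewrite ltz_nat absz_gt0 (nz (Ordinal ik)).
(* Divisibility does not see signs. *)
- rewrite sorted_map (@eq_sorted _ _ dvdz) ?take_sorted //.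
(* The signs of the diagonal are absorbed into the left factor, which stays unimodular. *)
- pose s := \row_(i < k) ((-1) ^+ (d`_i < 0)%R : int).
  exists (diag_mx s *m invmx L), (invmx R); split.
  + apply/unimodularP; rewrite unitmx_mul unitmx_inv uL andbT unitmxE det_diag.
    by apply: rpred_prod => i _; rewrite mxE rpredX // unitrN1.
  + by apply/unimodularP; rewrite unitmx_inv.
  rewrite {1}eM !mulmxA mulmxK // mulmxKV // mul_diag_mx.
  apply/matrixP=> i j; rewrite !mxE mulrnAr.
  by rewrite (nth_map 0) ?size_takel // nth_take // abszE normrEsign.
Qed.

Lemma smith_solutionP (k l : nat) (M : 'M[int]_(k, l + k)) (S P : 'M[int]_k)
    (Q : 'M[int]_(l + k)) (b : 'cV[int]_k) (z : 'cV[int]_(l + k)) :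
  P \in unitmx -> Q \in unitmx ->
  P *m M *m Q = cast_cols (row_mx S (0 : 'M_(k, l))) ->
  M *m z = b <->
  exists w0 w1, S *m w0 = P *m b /\ z = Q *m cast_rows (col_mx w0 w1).
Proof.
move=> uP uQ eS.
have SE (w0 : 'cV_k) (w1 : 'cV_l) :
    P *m (M *m (Q *m cast_rows (col_mx w0 w1))) = S *m w0.
  by rewrite !mulmxA eS castmx_mul_inner mul_row_col mul0mx addr0.
split=> [<- | [w0 [w1 [eb ->]]]]; last first.
  by apply: (can_inj (mulKmx uP)); rewrite SE.
(* The rows of [invmx Q *m z] are reindexed by [k + l], so that they split where [[S, 0]] does. *)
pose w := castmx (addnC l k, erefl 1%N) (invmx Q *m z).
have ez : z = Q *m cast_rows (col_mx (usubmx w) (dsubmx w)).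
  by rewrite vsubmxK cast_rowsK mulKVmx.
by exists (usubmx w), (dsubmx w); rewrite -(SE _ (dsubmx w)) -ez.
Qed.

Theorem lemma2 (n k l : nat) (n_gt0 : (0 < n)%N) (k_gt0 : (0 < k)%N)
    (l_gt0 : (0 < l)%N) (A : 'M[int]_(k, l)) (b : 'cV[int]_k) :
  let M : 'M[int]_(k, l + k) := row_mx A (- (n%:Z)%:M) in
  (exists f : k.-tuple int, invariant_factors M f) /\
  (forall f : k.-tuple int, invariant_factors M f ->
   let S : 'M[int]_k := diag_of_tuple f in
   let smith_transform (P : 'M[int]_k) (Q : 'M[int]_(l + k)) : Prop :=
     [/\ unimodular P, unimodular Q
       & P *m M *m Q = cast_cols (row_mx S (0 : 'M[int]_(k, l)))] in
   [/\ \det S != 0,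
       exists (P : 'M[int]_k) (Q : 'M[int]_(l + k)), smith_transform P Q
     & forall (P : 'M[int]_k) (Q : 'M[int]_(l + k)), smith_transform P Q ->
       let beta : 'cV[int]_k := P *m b in
       let x0 : 'cV[rat]_k := invmx (mxQ S) *m mxQ beta in
       [/\ (exists (x : 'cV[int]_l) (y : 'cV[int]_k), M *m col_mx x y = b)
             <-> x0 \is a mxOver Num.int,
           x0 \is a mxOver Num.int
             <-> (forall i : 'I_k, (tnth f i %| beta i 0%R)%Z)
         & x0 \is a mxOver Num.int ->
           forall (x : 'cV[int]_l) (y : 'cV[int]_k),
             M *m col_mx x y = b <->
             (exists x1 : 'cV[int]_l,
                mxQ (col_mx x y)
                = mxQ Q *m cast_rows (col_mx x0 (mxQ x1)))]]).
Proof.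
move=> M; split.
  apply: (@invariant_factors_exist _ _ _ (col_mx 0 (- 1%:M)) n%:Z).
  - exact: leq_addl.
  - by rewrite eqz_nat -lt0n.
  - by rewrite mul_row_col mulmx0 add0r mulmxN mulNmx opprK mulmx1.
move=> f [_ f_gt0 _ [U [V [uU uV eUV]]]] S smith_transform.
have detS : \det S != 0.
  rewrite det_diag; apply/prodf_neq0 => i _; rewrite mxE.
  by rewrite gt_eqF // (allP f_gt0) // mem_tnth.
split=> // [|P Q [/unimodularP uP /unimodularP uQ eS] beta x0].
  by exists U, V; split; rewrite // eUV smith_mxE.
have uS : mxQ S \in unitmx.
  by rewrite unitmxE det_map_mx unitfE intr_eq0.
(* This ties the rational vector [x0] to the integral equation: [S] is inverted over the rationals,
   and [mxQ] is injective. *)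
have x0P (w : 'cV[int]_k) : S *m w = beta <-> x0 = mxQ w.
  split=> [e | e]; first by rewrite /x0 -e mxQ_mul mulKmx.
  by apply: mxQ_inj; rewrite mxQ_mul -e mulKVmx.
have solP z := @smith_solutionP _ _ M S P Q b z uP uQ eS.
have castQ (w0 : 'cV[int]_k) (w1 : 'cV[int]_l) :
    mxQ (Q *m cast_rows (col_mx w0 w1))
    = mxQ Q *m cast_rows (col_mx (mxQ w0) (mxQ w1)).
  by rewrite mxQ_mul /cast_rows /mxQ map_castmx map_col_mx.
split.
- split=> [[x [y /solP[w0 [_ [/x0P e _]]]]] | /mxOver_intP[w0 /x0P e]].
    by apply/mxOver_intP; exists w0.
  (* The free component is set to [0]. *)
  pose z := Q *m cast_rows (col_mx w0 (0 : 'cV[int]_l)).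
  exists (usubmx z), (dsubmx z); rewrite vsubmxK.
  by apply/solP; exists w0, 0.
- split=> [/mxOver_intP[w0 /x0P e] i | dv].
    by rewrite -e mul_diag_mx !mxE dvdz_mulr.
  (* By [dv] these quotients are exact, so they solve the diagonal system. *)
  apply/mxOver_intP; exists (\col_i (beta i 0%R %/ tnth f i)%Z); apply/x0P.
  by apply/colP=> i; rewrite mul_diag_mx mxE [X in X * _]mxE [X in _ * X]mxE mulrC divzK.
- move=> /mxOver_intP[w0 e] x y; split.
    move=> /solP[w [w1 [/x0P ew ->]]].
    by exists w1; rewrite castQ -ew.
  (* Once [x0] is the image of [w0], both sides are images of integer vectors, and the equation
     descends to the integers. *)
  move=> [x1]; rewrite e -castQ => /mxQ_inj ez.
  by apply/solP; exists w0, x1; split=> //; apply/x0P.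
Qed.
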